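(* If $F\in S_m(\mathcal B,\varepsilon)$ with $m\ge2$ and $\varepsilon$ square summable, then $F$ is Fréchet differentiable on $H^2$ and, for all $X,Y\in H^2$, $$DF(X)\cdot Y=\sum_{j\in\Gamma}\left(\langle Y,u_j\rangle\frac{\partial F}{\partial u_j}(X)+\langle Y,v_j\rangle\frac{\partial F}{\partial v_j}(X)\right).$$ Moreover, for all $X,Y\in H^2$, $$|F(X+Y)-F(X)-DF(X)\cdot Y|\le\|F\|_{m,\varepsilon}\sum_{j\in\Gamma}\varepsilon_j^2\,(1+2\sqrt2)\,|Y|^2 .$$
   Context: $H$ is a real, separable, infinite dimensional Hilbert space (with the Hilbert space structure on $H^2$, scalar product $\langle\cdot,\cdot\rangle$, norm $|\cdot|$), and $B$ is a Banach space completing $H$ for a measurable norm (an abstract Wiener space), with $B'\subset H\subset B$. $\mathcal B=(e_j)_{j\in\Gamma}$ is a Hilbert basis of $H$ ($\Gamma$ countable) with all $e_j\in B'$; $u_j=(e_j,0)$, $v_j=(0,e_j)$. For $m\in\mathbb N$, $M\ge0$ and a family $\varepsilon=(\varepsilon_j)_{j\in\Gamma}$ of nonnegative reals, $S_m(\mathcal B,M,\varepsilon)$ is the set of bounded continuous $F:H^2\to\mathbb C$ such that for every pair of finitely supported multi-indices $(\alpha,\beta)$ with $0\le\alpha_j,\beta_j\le m$ for all $j$, the derivative $\prod_{j}\partial_{u_j}^{\alpha_j}\partial_{v_j}^{\beta_j}F$ exists, is continuous on $H^2$ and is bounded in modulus by $M\prod_j\varepsilon_j^{\alpha_j+\beta_j}$.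 $S_m(\mathcal B,\varepsilon)=\bigcup_{M\ge0}S_m(\mathcal B,M,\varepsilon)$ and $\|F\|_{m,\varepsilon}=\inf\{M\ge0: F\in S_m(\mathcal B,M,\varepsilon)\}$. *)

(* Defs.v *)
From Stdlib Require Import Reals List.
From Coquelicot Require Import Coquelicot.
From mathcomp Require ssreflect ssrfun ssrbool ssralg ssrnum.
From mathcomp Require classical_sets reals constructive_ereal Rstruct numfun.
From mathcomp Require measure lebesgue_measure lebesgue_integral.
From mathcomp Require normal_distribution.

Open Scope R_scope.

(** * Hilbert spaces *)

Record HilbertSpace := {
  hilbert_sort :> CompleteNormedModule R_AbsRing;
  inner : hilbert_sort -> hilbert_sort -> R;
  inner_sym : forall x y, inner x y = inner y x;
  inner_plus_l : forall x y z, inner (plus x y) z = inner x z + inner y z;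
  inner_scal_l : forall (a : R) x y, inner (scal a x) y = a * inner x y;
  inner_norm : forall x, norm x ^ 2 = inner x x
}.

Arguments inner {h} x y.

(** [H * H] carries Coquelicot's product norm, which is the Hilbertian one. *)

Definition inner2 {H : HilbertSpace} (X Y : H * H) : R :=
  inner (fst X) (fst Y) + inner (snd X) (snd Y).

Lemma inner2_norm {H : HilbertSpace} (X : H * H) : norm X ^ 2 = inner2 X X.
Proof.
unfold inner2; rewrite <- !inner_norm.
change (sqrt (norm (fst X) ^ 2 + norm (snd X) ^ 2) ^ 2
        = norm (fst X) ^ 2 + norm (snd X) ^ 2).
apply pow2_sqrt, Rplus_le_le_0_compat; apply pow2_ge_0.
Qed.

Definition list_sum {I : Type} {V : AbelianMonoid} (f : I -> V) (s : list I) : V :=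
  fold_right (fun j acc => plus (f j) acc) zero s.

Definition list_prod {I : Type} (f : I -> R) (s : list I) : R :=
  fold_right (fun j acc => f j * acc) 1 s.

Definition separable (H : HilbertSpace) : Prop :=
  exists d : nat -> H, forall (x : H) (r : R), 0 < r ->
    exists n, norm (minus x (d n)) < r.

Definition infinite_dim (H : HilbertSpace) : Prop :=
  forall s : list H, exists x : H,
    forall c : H -> R, x <> list_sum (fun y => scal (c y) y) s.

Definition countable_type (G : Type) : Prop :=
  exists c : G -> nat, forall i j, c i = c j -> i = j.

Definition hilbert_basis {H : HilbertSpace} {G : Type} (e : G -> H) : Prop :=
  (forall j, inner (e j) (e j) = 1) /\
  (forall i j, i <> j -> inner (e i) (e j) = 0) /\
  (forall (x : H) (r : R), 0 < r -> exists (s : list G) (c : G -> R),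
      norm (minus x (list_sum (fun j => scal (c j) (e j)) s)) < r).

(** Unordered summation: limit along the net of finite subsets of [G],
    represented by duplicate-free lists. *)

Definition is_usum {G : Type} {V : NormedModule R_AbsRing}
    (f : G -> V) (l : V) : Prop :=
  forall r : R, 0 < r -> exists s0 : list G, forall s : list G,
    NoDup s -> incl s0 s -> norm (minus (list_sum f s) l) < r.

(** * Abstract Wiener spaces *)

Module Gauss.

Import ssreflect ssrfun ssrbool ssralg ssrnum.
Import classical_sets reals constructive_ereal Rstruct numfun.
Import measure lebesgue_measure lebesgue_integral normal_distribution.

(** Law of the sum of [xi_k f_k], where [f_1, ..., f_n] are the entries of [s]
    and the [xi_k] are independent standard normal variables (product measure
    built by iterated integration). When [s] is orthonormal this is the standard
    Gaussian measure of the Euclidean space spanned by [s]. *)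
Fixpoint law {V : NormedModule R_AbsRing} (s : list V) (A : V -> Prop)
    : \bar R :=
  match s with
  | nil => ((\1_(A : set V) Hierarchy.zero) : R)%:E
  | cons f s' =>
      (\int[normal_prob (0 : R) (1 : R)]_x
          law s' (fun z => A (Hierarchy.plus (Hierarchy.scal (x : R) f) z)))%E
  end.

Definition law_lt {V : NormedModule R_AbsRing} (s : list V) (A : V -> Prop)
    (r : R) : Prop := is_true (law s A < r%:E)%E.

End Gauss.

Definition orthonormal_list {H : HilbertSpace} (s : list H) : Prop :=
  NoDup s /\ (forall x, In x s -> inner x x = 1) /\
  (forall x y, In x s -> In y s -> x <> y -> inner x y = 0).

Definition is_norm {H : HilbertSpace} (n : H -> R) : Prop :=
  (forall x y, n (plus x y) <= n x + n y) /\
  (forall (a : R) x, n (scal a x) = Rabs a * n x) /\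
  (forall x, n x = 0 -> x = zero).

(** Measurable norm in the sense of Gross. The finite dimensional subspace [E0]
    is given by a generating list [s0], the finite dimensional subspaces
    orthogonal to it by orthonormal bases [s]. *)
Definition measurable_norm {H : HilbertSpace} (n : H -> R) : Prop :=
  is_norm n /\
  forall r : R, 0 < r -> exists s0 : list H, forall s : list H,
    orthonormal_list s ->
    (forall x y, In x s0 -> In y s -> inner x y = 0) ->
    Gauss.law_lt s (fun x => n x > r) r.

Definition abstract_wiener {H : HilbertSpace} {B : CompleteNormedModule R_AbsRing}
    (i : H -> B) : Prop :=
  (forall x y, i (plus x y) = plus (i x) (i y)) /\
  (forall (a : R) x, i (scal a x) = scal a (i x)) /\
  (forall (b : B) (r : R), 0 < r -> exists x, norm (minus b (i x)) < r) /\
  measurable_norm (fun x => norm (i x)).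

(** [B'] is seen as a subset of [H] through the transpose of [i] and the Riesz
    isomorphism of [H] with its dual. *)
Definition in_dual {H : HilbertSpace} {B : CompleteNormedModule R_AbsRing}
    (i : H -> B) (y : H) : Prop :=
  exists phi : B -> R, is_linear phi /\ forall x : H, phi (i x) = inner y x.

(** * The classes S_m *)

Section SymbolClasses.

Context {H : HilbertSpace} {G : Type}.
Context (e : G -> H).

Definition u (j : G) : H * H := (e j, zero).
Definition v (j : G) : H * H := (zero, e j).

Definition is_partial (w : H * H) (F F' : H * H -> C) : Prop :=
  forall X, is_derive (V := C_R_NormedModule)
    (fun t : R => F (plus X (scal t w))) 0 (F' X).

Definition partial (w : H * H) (F : H * H -> C) (X : H * H) : C :=
  (Derive (fun t : R => fst (F (plus X (scal t w)))) 0,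
   Derive (fun t : R => snd (F (plus X (scal t w)))) 0).

Lemma is_partial_unique (w : H * H) (F F' : H * H -> C) (X : H * H) :
  is_partial w F F' -> partial w F X = F' X.
Proof.
intros HF; specialize (HF X); unfold partial.
rewrite (surjective_pairing (F' X)).
f_equal; apply is_derive_unique.
- apply (filterdiff_comp' _ (fun z : C_R_NormedModule => fst z) 0
    (fun y : R => scal y (F' X)) (fun z => fst z) HF).
  apply filterdiff_linear, is_linear_fst.
- apply (filterdiff_comp' _ (fun z : C_R_NormedModule => snd z) 0
    (fun y : R => scal y (F' X)) (fun z => snd z) HF).
  apply filterdiff_linear, is_linear_snd.
Qed.

Fixpoint is_partial_n (n : nat) (w : H * H) (F F' : H * H -> C) : Prop :=
  match n with
  | O => forall X, F' X = F X
  | S n' => exists F1, is_partial_n n' w F F1 /\ is_partial w F1 F'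
  end.

(** [F'] is the derivative of [F] by the product over [j] in [s], in the order
    of the list, of the operators [d_{u_j}^(a j) d_{v_j}^(b j)]. *)
Fixpoint is_mixed_partial (s : list G) (a b : G -> nat)
    (F F' : H * H -> C) : Prop :=
  match s with
  | nil => forall X, F' X = F X
  | j :: s' => exists F1 F2, is_mixed_partial s' a b F F1 /\
      is_partial_n (b j) (v j) F1 F2 /\ is_partial_n (a j) (u j) F2 F'
  end.

(** A finitely supported multi-index is given with a duplicate-free list [s]
    containing its support; since [s] is arbitrary, the mixed derivative is
    required to exist for every ordering of the indices. *)
Definition in_SM (m : nat) (M : R) (eps : G -> R) (F : H * H -> C) : Prop :=
  (forall X, continuous F X) /\
  (exists K : R, forall X, Cmod (F X) <= K) /\
  forall (s : list G) (a b : G -> nat),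
    NoDup s ->
    (forall j, ~ In j s -> a j = O /\ b j = O) ->
    (forall j, (a j <= m)%nat /\ (b j <= m)%nat) ->
    exists F' : H * H -> C,
      is_mixed_partial s a b F F' /\
      (forall X, continuous F' X) /\
      (forall X, Cmod (F' X) <= M * list_prod (fun j => eps j ^ (a j + b j)) s).

Definition in_S (m : nat) (eps : G -> R) (F : H * H -> C) : Prop :=
  exists M : R, 0 <= M /\ in_SM m M eps F.

Definition normS (m : nat) (eps : G -> R) (F : H * H -> C) : R :=
  real (Glb_Rbar (fun M => 0 <= M /\ in_SM m M eps F)).

End SymbolClasses.

(* Main.v *)
From Stdlib Require Import Reals List Lra Lia FunctionalExtensionality Classical.
From Coquelicot Require Import Coquelicot.
Require Import Defs.
Open Scope R_scope.

(** Moving from [X] to [X + Y] one basis direction at a time, for [Y] in the span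
    of finitely many [u_j], [v_j] and with coordinates [y_k], the k-th step costs
    [M eps_k^2 |y_k|^2] (mean value inequality for the partial derivative along
    the step) and replacing the partial derivative at the current point by the
    one at [X] costs [M eps_k |y_k| * sum_(l before k) eps_l |y_l|]. The total is
    at most [M (sum_k eps_k |y_k|)^2 <= M * 2 S2 * |Y|^2] by Cauchy-Schwarz and
    Bessel, better than the factor [1 + 2 sqrt 2]. The general case follows by
    continuity of [F], projecting [Y] on finite parts of the basis; the series of
    the differential converges absolutely by the same Cauchy-Schwarz bound. *)

(** * Complex modulus, decidability of indices, and abelian group identities *)

Lemma Cmod_norm (z : C) : Cmod z = norm (z : C_R_NormedModule).
Proof.
change (sqrt (fst z ^ 2 + snd z ^ 2) = sqrt (Rabs (fst z) ^ 2 + Rabs (snd z) ^ 2)).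
now rewrite !pow2_abs.
Qed.

Lemma RtoC_mult_scal (a : R) (z : C) : (RtoC a * z)%C = scal a (z : C_R_NormedModule).
Proof.
unfold scal; simpl; unfold prod_scal, scal; simpl; unfold mult; simpl.
unfold Cmult, RtoC; simpl; f_equal; ring.
Qed.

(** Decidable equality gives access to [nodup] and to multi-indices defined by case distinction. The
    injection into [nat] is only known in [Prop], hence [inhabited]. *)
Lemma countable_eq_dec (G : Type) :
  countable_type G -> inhabited (forall x y : G, {x = y} + {x <> y}).
Proof.
intros [c Hc]; constructor; intros x y.
destruct (Nat.eq_dec (c x) (c y)) as [E | E].
- left; now apply Hc.
- right; now intros ->.
Qed.

Lemma minus_plus_l {V : AbelianGroup} (x y z : V) :
  minus (plus x y) (plus x z) = minus y z.
Proof.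
unfold minus; rewrite opp_plus, (plus_comm x y), <- plus_assoc.
now rewrite (plus_assoc x), plus_opp_r, plus_zero_l.
Qed.

Lemma minus_plus_r {V : AbelianGroup} (x y z : V) :
  minus (plus y x) (plus z x) = minus y z.
Proof. rewrite !(plus_comm _ x); apply minus_plus_l. Qed.

Lemma minus_minus {V : AbelianGroup} (x y z : V) :
  minus (minus x y) z = minus x (plus z y).
Proof.
unfold minus; rewrite opp_plus, <- plus_assoc; f_equal; apply plus_comm.
Qed.

Lemma minus_plus_cancel {V : AbelianGroup} (x y : V) : plus (minus x y) y = x.
Proof. unfold minus; now rewrite <- plus_assoc, plus_opp_l, plus_zero_r. Qed.

Lemma norm_minus_le {V : NormedModule R_AbsRing} (x y z : V) :
  norm (minus x y) <= norm (minus x z) + norm (minus y z).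
Proof.
rewrite <- (minus_plus_r (V := NormedModule.AbelianGroup _ V) (opp z) x y).
refine (Rle_trans _ _ _ (norm_triangle _ _) _).
rewrite norm_opp; apply Rle_refl.
Qed.

(** * Finite sums over lists *)

Lemma list_sum_app {I : Type} {V : AbelianMonoid} (f : I -> V) (s t : list I) :
  list_sum f (s ++ t) = plus (list_sum f s) (list_sum f t).
Proof.
induction s as [| j s IH]; simpl.
- now rewrite plus_zero_l.
- now rewrite IH, plus_assoc.
Qed.

Lemma list_sum_map {I J : Type} {V : AbelianMonoid} (f : I -> V) (g : J -> I)
    (s : list J) :
  list_sum f (map g s) = list_sum (fun j => f (g j)) s.
Proof. induction s as [| j s IH]; simpl; [easy | now rewrite IH]. Qed.

Lemma list_sum_ext {I : Type} {V : AbelianMonoid} (f g : I -> V) (s : list I) :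
  (forall j, f j = g j) -> list_sum f s = list_sum g s.
Proof. intros E; induction s as [| j s IH]; simpl; [easy | now rewrite E, IH]. Qed.

Lemma list_sum_plus {I : Type} {V : AbelianMonoid} (f g : I -> V) (s : list I) :
  list_sum (fun j => plus (f j) (g j)) s = plus (list_sum f s) (list_sum g s).
Proof.
induction s as [| j s IH]; simpl.
- now rewrite plus_zero_l.
- rewrite IH, <- !plus_assoc; f_equal.
  rewrite !plus_assoc; f_equal; apply plus_comm.
Qed.

Lemma list_sum_scal {I : Type} {V : NormedModule R_AbsRing} (a : R) (f : I -> V)
    (s : list I) :
  list_sum (fun j => scal a (f j)) s = scal a (list_sum f s).
Proof.
induction s as [| j s IH]; simpl.
- symmetry; exact (scal_zero_r (V := NormedModule.ModuleSpace _ V) a).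
- rewrite IH; symmetry; exact (scal_distr_l (V := NormedModule.ModuleSpace _ V) a _ _).
Qed.

Lemma list_sum_insert {I : Type} {V : AbelianMonoid} (f : I -> V) (j : I)
    (s t : list I) :
  list_sum f (s ++ j :: t) = plus (f j) (list_sum f (s ++ t)).
Proof.
rewrite !list_sum_app; simpl.
rewrite !plus_assoc; f_equal; apply plus_comm.
Qed.

Lemma norm_list_sum {I : Type} {V : NormedModule R_AbsRing} (f : I -> V)
    (s : list I) :
  norm (list_sum f s) <= list_sum (V := R_AbelianMonoid) (fun j => norm (f j)) s.
Proof.
induction s as [| j s IH]; simpl.
- rewrite norm_zero; apply Rle_refl.
- eapply Rle_trans; [apply norm_triangle | now apply Rplus_le_compat_l].
Qed.

Lemma list_sum_nonneg {I : Type} (f : I -> R) (s : list I) :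
  (forall j, 0 <= f j) -> 0 <= list_sum (V := R_AbelianMonoid) f s.
Proof.
intros Hf; induction s as [| j s IH]; simpl.
- apply Rle_refl.
- now apply Rplus_le_le_0_compat.
Qed.

Lemma list_sum_le {I : Type} (f g : I -> R) (s : list I) :
  (forall j, f j <= g j) ->
  list_sum (V := R_AbelianMonoid) f s <= list_sum (V := R_AbelianMonoid) g s.
Proof.
intros Hf; induction s as [| j s IH]; simpl.
- apply Rle_refl.
- now apply Rplus_le_compat.
Qed.

(** Striking the elements of [s] out of [t] leaves a list whose sum is the difference; the triangle
    inequality is applied to these leftovers only. This is the Cauchy estimate behind absolute
    convergence. *)
Lemma norm_list_sum_diff {I : Type} {V : NormedModule R_AbsRing} (f : I -> V)
    (s t : list I) :
  NoDup s -> incl s t ->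
  norm (minus (list_sum f t) (list_sum f s)) <=
  list_sum (V := R_AbelianMonoid) (fun j => norm (f j)) t
  - list_sum (V := R_AbelianMonoid) (fun j => norm (f j)) s.
Proof.
intros Hs; revert t; induction Hs as [| j s Hj Hs IH]; intros t Hst; simpl.
- rewrite (minus_zero_r (G := NormedModule.AbelianGroup _ V)).
  change (@zero R_AbelianMonoid) with 0; rewrite Rminus_0_r.
  apply norm_list_sum.
- destruct (in_split j t) as (t1 & t2 & ->); [apply Hst; now left |].
  rewrite !list_sum_insert.
  assert (Hi : incl s (t1 ++ t2)).
  { intros x Hx; assert (Hx' := Hst x (or_intror Hx)).
    rewrite in_app_iff in *; simpl in Hx'.
    destruct Hx' as [? | [-> | ?]]; tauto. }
  specialize (IH _ Hi).
  rewrite (minus_plus_l (V := NormedModule.AbelianGroup _ V)).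
  refine (Rle_trans _ _ _ IH _); unfold plus; simpl; lra.
Qed.

Lemma list_sum_incl_le {I : Type} (f : I -> R) (s t : list I) :
  (forall j, 0 <= f j) -> NoDup s -> incl s t ->
  list_sum (V := R_AbelianMonoid) f s <= list_sum (V := R_AbelianMonoid) f t.
Proof.
intros Hf Hs Hst.
assert (E : forall l, list_sum (V := R_AbelianMonoid)
    (fun j => norm (V := R_NormedModule) (f j)) l
    = list_sum (V := R_AbelianMonoid) f l).
{ intros l; apply list_sum_ext; intros j; now apply Rabs_pos_eq. }
assert (L := norm_list_sum_diff (V := R_NormedModule) f s t Hs Hst).
rewrite !E in L.
assert (N := norm_ge_0 (V := R_NormedModule)
  (minus (list_sum (V := R_AbelianMonoid) f t) (list_sum (V := R_AbelianMonoid) f s))).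
apply Rminus_le_0; exact (Rle_trans _ _ _ N L).
Qed.

Lemma Cauchy_Schwarz_step (x y T P Q : R) :
  0 <= P -> 0 <= Q -> T ^ 2 <= P * Q ->
  (x * y + T) ^ 2 <= (x ^ 2 + P) * (y ^ 2 + Q).
Proof.
intros HP HQ HT.
assert (Hx := pow2_ge_0 x); assert (Hy := pow2_ge_0 y).
(* The cross term is handled by comparing squares: [4 x^2 y^2 T^2] is at most [4 (x^2 Q) (y^2 P)],
   which is at most [(x^2 Q + y^2 P)^2]. *)
assert (K : 2 * (x * y * T) <= x ^ 2 * Q + y ^ 2 * P).
{ apply Rsqr_incr_0_var; [| nra].
  unfold Rsqr.
  assert (0 <= (x ^ 2 * Q - y ^ 2 * P) ^ 2) by apply pow2_ge_0.
  assert ((x * y) ^ 2 * T ^ 2 <= (x * y) ^ 2 * (P * Q))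
    by (apply Rmult_le_compat_l; [apply pow2_ge_0 | easy]).
  nra. }
nra.
Qed.

Lemma list_sum_Cauchy_Schwarz {I : Type} (a b : I -> R) (s : list I) :
  list_sum (V := R_AbelianMonoid) (fun j => a j * b j) s ^ 2
  <= list_sum (V := R_AbelianMonoid) (fun j => a j ^ 2) s
     * list_sum (V := R_AbelianMonoid) (fun j => b j ^ 2) s.
Proof.
induction s as [| j s IH].
- simpl; change (@zero R_AbelianMonoid) with 0; lra.
- apply Cauchy_Schwarz_step; [| | exact IH];
    apply list_sum_nonneg; intros; apply pow2_ge_0.
Qed.

(** * Unordered sums *)

(** The net of finite subsets encoded as a filter, so that limit theorems for filters apply to
    unordered sums. *)
Definition finite_net {G : Type} (P : list G -> Prop) : Prop :=
  exists s0, forall s, NoDup s -> incl s0 s -> P s.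

Lemma finite_net_filter {G : Type} (dec : forall x y : G, {x = y} + {x <> y}) :
  ProperFilter (@finite_net G).
Proof.
split.
(* The base list may contain repetitions; removing them produces a list that belongs to its own
   tail, so no set of the filter is empty. *)
- intros P [s0 HP]; exists (nodup dec s0); apply HP.
  + apply NoDup_nodup.
  + intros x Hx; now apply nodup_In.
- split.
  + now exists nil.
  + intros P Q [s HP] [t HQ]; exists (s ++ t); intros l Hl Hi.
    apply incl_app_inv in Hi; split; [apply HP | apply HQ]; tauto.
  + intros P Q HPQ [s HP]; exists s; auto.
Qed.

Lemma is_usum_filterlim {G : Type} {V : NormedModule R_AbsRing}
    (dec : forall x y : G, {x = y} + {x <> y}) (f : G -> V) (l : V) :
  is_usum f l <-> filterlim (list_sum f) finite_net (locally l).
Proof.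
assert (PF := finite_net_filter dec).
assert (E := filterlim_locally_ball_norm (F := @finite_net G) (list_sum f) l).
split; intros Hl.
- apply E; intros r; exact (Hl r (cond_pos r)).
- intros r Hr; exact (proj1 E Hl (mkposreal r Hr)).
Qed.

Lemma is_usum_unique {G : Type} {V : NormedModule R_AbsRing}
    (dec : forall x y : G, {x = y} + {x <> y}) (f : G -> V) (l l' : V) :
  is_usum f l -> is_usum f l' -> l = l'.
Proof.
assert (PF := finite_net_filter dec).
rewrite !(is_usum_filterlim dec); apply filterlim_locally_unique.
Qed.

Lemma is_usum_ext {G : Type} {V : NormedModule R_AbsRing} (f g : G -> V) (l : V) :
  (forall j, f j = g j) -> is_usum f l -> is_usum g l.
Proof.
intros E Hf r Hr; destruct (Hf r Hr) as [s0 H0]; exists s0; intros s Hs Hi.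
rewrite <- (list_sum_ext f g s E); now apply H0.
Qed.

Lemma is_usum_plus {G : Type} {V : NormedModule R_AbsRing}
    (dec : forall x y : G, {x = y} + {x <> y}) (f g : G -> V) (l l' : V) :
  is_usum f l -> is_usum g l' -> is_usum (fun j => plus (f j) (g j)) (plus l l').
Proof.
assert (PF := finite_net_filter dec).
rewrite !(is_usum_filterlim dec); intros Hf Hg.
apply filterlim_ext with (fun s => plus (list_sum f s) (list_sum g s)).
- intros s; symmetry; apply list_sum_plus.
- exact (filterlim_comp_2 _ _ plus Hf Hg (filterlim_plus l l')).
Qed.

Lemma is_usum_scal {G : Type} {V : NormedModule R_AbsRing}
    (dec : forall x y : G, {x = y} + {x <> y}) (a : R) (f : G -> V) (l : V) :
  is_usum f l -> is_usum (fun j => scal a (f j)) (scal a l).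
Proof.
assert (PF := finite_net_filter dec).
rewrite !(is_usum_filterlim dec); intros Hf.
apply filterlim_ext with (fun s => scal a (list_sum f s)).
- intros s; symmetry; apply list_sum_scal.
- exact (filterlim_comp _ _ _ _ _ _ _ _ Hf (filterlim_scal_r a l)).
Qed.

Lemma is_usum_norm_le {G : Type} {V : NormedModule R_AbsRing}
    (dec : forall x y : G, {x = y} + {x <> y}) (f : G -> V) (l : V) (K : R) :
  is_usum f l -> (forall s, NoDup s -> norm (list_sum f s) <= K) -> norm l <= K.
Proof.
intros Hf HK; apply le_epsilon; intros r Hr.
destruct (Hf r Hr) as [s0 H0].
specialize (H0 (nodup dec s0) (NoDup_nodup _ _) (fun x Hx => proj2 (nodup_In dec s0 x) Hx)).
specialize (HK _ (NoDup_nodup dec s0)).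
assert (T := norm_triangle_inv (list_sum f (nodup dec s0)) l).
apply Rabs_le_between in T; lra.
Qed.

(** With nonnegative terms, enlarging [s] does not lower the sum, and a large enough enlargement has
    a sum within [r] of the limit. *)
Lemma list_sum_le_usum {G : Type} (dec : forall x y : G, {x = y} + {x <> y})
    (f : G -> R) (l : R) (s : list G) :
  (forall j, 0 <= f j) -> is_usum (V := R_NormedModule) f l -> NoDup s ->
  list_sum (V := R_AbelianMonoid) f s <= l.
Proof.
intros Hf Hl Hs; apply le_epsilon; intros r Hr.
destruct (Hl r Hr) as [s0 H0].
assert (Hi : forall x, In x (s0 ++ s) -> In x (nodup dec (s0 ++ s)))
  by (intros x; apply nodup_In).
specialize (H0 (nodup dec (s0 ++ s)) (NoDup_nodup _ _)
  (fun x Hx => Hi x (in_or_app _ _ _ (or_introl Hx)))).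
assert (Hx : forall x, Rabs (x - l) < r -> x <= l + r)
  by (intros x Hx; apply Rabs_lt_between in Hx; lra).
refine (Rle_trans _ _ _ _ (Hx _ H0)).
apply (list_sum_incl_le f s _ Hf Hs).
intros x Hi'; apply Hi, in_or_app; now right.
Qed.

(** Absolute convergence: with [L] the supremum of the finite sums of norms and [s0] a list whose
    sum exceeds [L - r / 2], every larger list changes the sum of [f] by less than [r / 2]. The net
    is therefore Cauchy. *)
Lemma ex_usum {G : Type} {V : CompleteNormedModule R_AbsRing}
    (dec : forall x y : G, {x = y} + {x <> y}) (f : G -> V) (K : R) :
  (forall s, NoDup s ->
     list_sum (V := R_AbelianMonoid) (fun j => norm (f j)) s <= K) ->
  exists l, is_usum f l.
Proof.
intros HK.
assert (PF := finite_net_filter dec).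
set (g := list_sum (V := R_AbelianMonoid) (fun j => norm (f j))).
destruct (completeness (fun x => exists s, NoDup s /\ x = g s)) as [L [HL1 HL2]].
- exists K; intros x (s & Hs & ->); now apply HK.
- exists (g nil), nil; split; [constructor | easy].
- assert (Hlim : exists l, filterlim (list_sum f) finite_net (locally l)).
  { apply (filterlim_locally_cauchy (U := V)); intros r.
    assert (Hr := cond_pos r).
    destruct (classic (exists s0, NoDup s0 /\ L - r / 2 < g s0))
      as [(s0 & Hs0 & Hg) | N].
    - exists (fun s => norm (minus (list_sum f s) (list_sum f s0)) < r / 2).
      split.
      + exists s0; intros s Hs Hi.
        refine (Rle_lt_trans _ _ _ (norm_list_sum_diff (V := V) f s0 s Hs0 Hi) _).
        assert (g s <= L) by (apply HL1; now exists s).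
        unfold g in *; simpl in *; lra.
      + intros s t Hs Ht.
        refine (norm_compat1 (V := CompleteNormedModule.NormedModule _ V) _ _ _ _).
        refine (Rle_lt_trans _ _ _ (norm_minus_le (V := V) _ _ (list_sum f s0)) _).
        rewrite <- (Rplus_half_diag r); exact (Rplus_lt_compat _ _ _ _ Ht Hs).
    - exfalso; assert (L <= L - r / 2); [| lra].
      apply HL2; intros x (s & Hs & ->).
      apply Rnot_lt_le; intros Hlt; apply N; now exists s. }
  destruct Hlim as [l Hl]; exists l; now apply (is_usum_filterlim dec).
Qed.

(** * Orthonormal expansions *)

(** For orthonormal [e] and duplicate-free [s], the orthogonal projection onto the span of the
    [e j]; a repeated index would count twice. *)
Definition proj {H : HilbertSpace} {G : Type} (e : G -> H) (s : list G) (x : H) : H :=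
  list_sum (V := CompleteNormedModule.AbelianMonoid _ H)
    (fun j => scal (inner x (e j)) (e j)) s.

Lemma inner_zero_l {H : HilbertSpace} (y : H) : inner zero y = 0.
Proof.
assert (E := inner_plus_l H zero zero y); rewrite plus_zero_l in E; lra.
Qed.

Lemma inner_opp_l {H : HilbertSpace} (x y : H) : inner (opp x) y = - inner x y.
Proof.
assert (E := inner_plus_l H x (opp x) y).
replace (plus x (opp x)) with (@zero H) in E by (symmetry; exact (plus_opp_r (G := CompleteNormedModule.AbelianGroup _ H) x)).
rewrite inner_zero_l in E; lra.
Qed.

Lemma inner_list_sum_l {H : HilbertSpace} {I : Type} (f : I -> H) (s : list I) (y : H) :
  inner (list_sum f s) y
  = list_sum (V := R_AbelianMonoid) (fun j => inner (f j) y) s.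
Proof.
induction s as [| j s IH]; simpl.
- apply inner_zero_l.
- now rewrite inner_plus_l, IH.
Qed.

Lemma inner_proj_notin {H : HilbertSpace} {G : Type} (e : G -> H) (x : H) (j : G)
    (s : list G) :
  hilbert_basis e -> ~ In j s -> inner (proj e s x) (e j) = 0.
Proof.
intros (_ & He & _) Hj; unfold proj; rewrite inner_list_sum_l.
induction s as [| k s IH]; simpl in *; [easy |].
rewrite IH, inner_scal_l, He by tauto.
unfold plus; simpl; ring.
Qed.

Lemma inner_proj_in {H : HilbertSpace} {G : Type} (e : G -> H) (x : H) (j : G)
    (s : list G) :
  hilbert_basis e -> NoDup s -> In j s -> inner (proj e s x) (e j) = inner x (e j).
Proof.
intros He Hs; induction Hs as [| k s Hk Hs IH]; simpl; [easy |]; intros Hj.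
rewrite inner_plus_l, inner_scal_l; fold (proj e s x).
destruct He as (He1 & He2 & He3).
destruct Hj as [-> | Hj].
- rewrite inner_proj_notin, He1; try easy; ring.
- rewrite IH, He2; try easy; [ring |]; intros ->; easy.
Qed.

(** Pythagoras: the projection [p] satisfies [inner p p = inner p x], and both equal the sum of the
    squared coordinates. *)
Lemma norm_sub_proj {H : HilbertSpace} {G : Type} (e : G -> H) (x : H) (s : list G) :
  hilbert_basis e -> NoDup s ->
  norm (minus x (proj e s x)) ^ 2
  = norm x ^ 2 - list_sum (V := R_AbelianMonoid) (fun j => inner x (e j) ^ 2) s.
Proof.
intros He Hs.
rewrite !inner_norm; unfold minus.
set (p := proj e s x).
assert (E1 : inner p x
  = list_sum (V := R_AbelianMonoid) (fun j => inner x (e j) ^ 2) s).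
{ unfold p, proj; rewrite inner_list_sum_l; apply list_sum_ext; intros j.
  rewrite inner_scal_l, (inner_sym H (e j)); refine (_ : @eq R _ _); ring. }
assert (E2 : inner p p = inner p x).
{ unfold p at 1 3, proj; rewrite !inner_list_sum_l.
  assert (Hin : forall j, In j s -> inner p (e j) = inner x (e j))
    by (intros j; now apply inner_proj_in).
  (* In the induction [p] must remain the projection on the whole list while the sums shrink, so
     only its coordinates [Hin] are retained. *)
  clearbody p; clear Hs E1; induction s as [| j s IH]; simpl; [easy |].
  rewrite IH by (intros k Hk; apply Hin; now right).
  rewrite !inner_scal_l, !(inner_sym H (e j)).
  now rewrite (Hin j (or_introl eq_refl)). }
rewrite inner_plus_l, inner_opp_l, !(inner_sym H _ (plus x _)), !inner_plus_l.
rewrite !inner_opp_l, (inner_sym H x p), E2, E1; ring.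
Qed.

Lemma Bessel {H : HilbertSpace} {G : Type} (e : G -> H) (x : H) (s : list G) :
  hilbert_basis e -> NoDup s ->
  list_sum (V := R_AbelianMonoid) (fun j => inner x (e j) ^ 2) s <= norm x ^ 2.
Proof.
intros He Hs; assert (E := norm_sub_proj e x s He Hs).
assert (P := pow2_ge_0 (norm (minus x (proj e s x)))); lra.
Qed.

Lemma proj_plus {H : HilbertSpace} {G : Type} (e : G -> H) (s : list G) (x y : H) :
  proj e s (plus x y) = plus (proj e s x) (proj e s y).
Proof.
unfold proj; rewrite <- list_sum_plus; apply list_sum_ext; intros j.
rewrite inner_plus_l; exact (scal_distr_r (V := NormedModule.ModuleSpace _ H) _ _ _).
Qed.

Lemma proj_scal {H : HilbertSpace} {G : Type} (e : G -> H) (s : list G) (a : R) (x : H) :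
  proj e s (scal a x) = scal a (proj e s x).
Proof.
unfold proj; rewrite <- (list_sum_scal (V := H)); apply list_sum_ext; intros j.
rewrite inner_scal_l; symmetry.
exact (scal_assoc (V := NormedModule.ModuleSpace _ H) _ _ _).
Qed.

(** By [norm_sub_proj] the squared distance is 1 minus a sum of squares that already contains the
    term 1 of index [j], hence it vanishes. *)
Lemma proj_basis {H : HilbertSpace} {G : Type} (e : G -> H) (s : list G) (j : G) :
  hilbert_basis e -> NoDup s -> In j s -> proj e s (e j) = e j.
Proof.
intros He Hs Hj.
assert (He' := He); destruct He' as (He1 & He2 & _).
assert (E := norm_sub_proj e (e j) s He Hs).
assert (L : 1 <= list_sum (V := R_AbelianMonoid) (fun k => inner (e j) (e k) ^ 2) s).
{ replace 1 with (list_sum (V := R_AbelianMonoid)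
      (fun k => inner (e j) (e k) ^ 2) (j :: nil)).
  - apply list_sum_incl_le.
    + intros; apply pow2_ge_0.
    + repeat constructor; easy.
    + intros k [<- | []]; easy.
  - simpl; rewrite He1; unfold plus, zero; simpl; ring. }
rewrite (inner_norm H (e j)), He1 in E.
assert (Z : norm (minus (e j) (proj e s (e j))) = 0).
{ assert (P := pow2_ge_0 (norm (minus (e j) (proj e s (e j))))).
  apply Rsqr_0_uniq; unfold Rsqr; lra. }
apply norm_eq_zero in Z.
symmetry; now apply (plus_reg_r (opp (proj e s (e j)))); rewrite plus_opp_r.
Qed.

(** A combination [p] of basis vectors within [r] of [x] is fixed by every projection on a list
    containing its indices. The error for [x] is then the error for [minus x p], whose norm is at
    most that of [minus x p]. *)
Lemma proj_cvg {H : HilbertSpace} {G : Type} (e : G -> H) (x : H) (r : R) :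
  hilbert_basis e -> 0 < r ->
  finite_net (fun s => norm (minus x (proj e s x)) < r).
Proof.
intros He Hr.
destruct (proj2 (proj2 He) x r Hr) as (s0 & c & Hx).
pose (p := list_sum (V := CompleteNormedModule.AbelianMonoid _ H)
  (fun j => scal (c j) (e j)) s0).
change (norm (minus x p) < r) in Hx.
exists s0; intros s Hs Hi.
refine (Rle_lt_trans _ _ _ _ Hx).
assert (Ep : proj e s p = p).
{ unfold p; clear p Hx; induction s0 as [| j s0 IH]; simpl.
  - assert (E := proj_scal e s 0 zero).
    now rewrite !(scal_zero_l (V := NormedModule.ModuleSpace _ H)) in E.
  - rewrite proj_plus, proj_scal, IH, proj_basis; try easy.
    + apply Hi; now left.
    + intros k Hk; apply Hi; now right. }
replace (minus x (proj e s x)) with (minus (minus x p) (proj e s (minus x p))).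
- apply Rsqr_incr_0_var; [| apply norm_ge_0].
  rewrite !Rsqr_pow2, (norm_sub_proj e (minus x p) s He Hs).
  assert (P := list_sum_nonneg (fun j => inner (minus x p) (e j) ^ 2) s
    (fun j => pow2_ge_0 _)); lra.
- replace (proj e s x) with (plus (proj e s (minus x p)) p).
  + exact (minus_minus (V := CompleteNormedModule.AbelianGroup _ H) _ _ _).
  + rewrite <- Ep at 2; rewrite <- proj_plus; f_equal.
    exact (minus_plus_cancel (V := CompleteNormedModule.AbelianGroup _ H) _ _).
Qed.

(** * A mean value inequality along finitely many directions *)

(* Testing [h] against the direction of its own increment reduces to a
   real-valued function without losing a factor. *)
Lemma C_bounded_variation (h dh : R -> C) (D x y : R) :
  (forall t, Rabs (t - x) <= Rabs (y - x) ->
     is_derive (V := C_R_NormedModule) h t (dh t) /\ Cmod (dh t) <= D) ->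
  Cmod (h y - h x)%C <= D * Rabs (y - x).
Proof.
intros Hh.
set (z := (h y - h x)%C).
assert (HD : 0 <= D).
{ destruct (Hh x) as [_ HD].
  - rewrite Rminus_diag, Rabs_R0; apply Rabs_pos.
  - eapply Rle_trans; [apply Cmod_ge_0 | exact HD]. }
assert (Hz := Cmod_ge_0 z).
assert (B : Rabs ((fst z * fst (h y) + snd z * snd (h y))
                  - (fst z * fst (h x) + snd z * snd (h x)))
            <= (Cmod z * D) * Rabs (y - x)).
{ apply (bounded_variation (fun t => fst z * fst (h t) + snd z * snd (h t))
    (fun t => fst z * fst (dh t) + snd z * snd (dh t))).
  intros t Ht; destruct (Hh t Ht) as [Hd Hb]; split.
  - apply (is_derive_plus (K := R_AbsRing) (V := R_NormedModule));
      apply is_derive_scal.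
    + apply (filterdiff_comp' _ (fun z : C_R_NormedModule => fst z) t
        (fun y : R => scal y (dh t)) (fun z => fst z) Hd).
      apply filterdiff_linear, is_linear_fst.
    + apply (filterdiff_comp' _ (fun z : C_R_NormedModule => snd z) t
        (fun y : R => scal y (dh t)) (fun z => snd z) Hd).
      apply filterdiff_linear, is_linear_snd.
  - apply Rle_trans with (Cmod z * Cmod (dh t)).
    + unfold Cmod; rewrite <- sqrt_mult by
        (apply Rplus_le_le_0_compat; apply pow2_ge_0).
      rewrite <- sqrt_Rsqr_abs; apply sqrt_le_1_alt; unfold Rsqr.
      (* Cauchy-Schwarz in the plane, through Lagrange's identity. *)
      assert (0 <= (fst z * snd (dh t) - snd z * fst (dh t)) ^ 2) by apply pow2_ge_0.
      nra.
    + now apply Rmult_le_compat_l. }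
replace (_ - _) with (Cmod z * Cmod z) in B.
- destruct (Req_dec (Cmod z) 0) as [E | N].
  + rewrite E; apply Rmult_le_pos; [easy | apply Rabs_pos].
  + rewrite Rabs_pos_eq in B by now apply Rmult_le_pos.
    rewrite Rmult_assoc in B; apply Rmult_le_reg_l in B; [easy | lra].
- unfold Cmod; rewrite sqrt_sqrt by (apply Rplus_le_le_0_compat; apply pow2_ge_0).
  unfold z; simpl; ring.
Qed.

(** [is_partial] differentiates at parameter 0 only, but at every base point; taking
    [plus X (scal t w)] as base point moves the derivative to [t]. *)
Lemma is_partial_line {H : HilbertSpace} (w : H * H) (f f' : H * H -> C)
    (X : H * H) (t : R) :
  is_partial w f f' ->
  is_derive (V := C_R_NormedModule) (fun t => f (plus X (scal t w))) t
    (f' (plus X (scal t w))).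
Proof.
intros Hf.
apply is_derive_ext with
  (fun s => f (plus (plus X (scal t w)) (scal (s - t) w))).
- intros s; f_equal; rewrite <- plus_assoc; f_equal.
  rewrite <- (scal_distr_r (V := prod_ModuleSpace _ H H)); f_equal.
  unfold plus; simpl; ring.
- replace (f' (plus X (scal t w))) with (scal 1 (f' (plus X (scal t w)))).
  + apply (is_derive_comp (V := C_R_NormedModule)
      (fun r => f (plus (plus X (scal t w)) (scal r w))) (fun s => s - t)).
    * rewrite Rminus_diag; apply Hf.
    * auto_derive; [easy | ring].
  + apply (scal_one (V := C_R_NormedModule)).
Qed.

Lemma partial_increment {H : HilbertSpace} (w : H * H) (f f' : H * H -> C)
    (D t : R) (X : H * H) :
  is_partial w f f' -> (forall Z, Cmod (f' Z) <= D) ->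
  Cmod (f (plus X (scal t w)) - f X)%C <= Rabs t * D.
Proof.
intros Hf HD.
assert (B := C_bounded_variation (fun t => f (plus X (scal t w)))
  (fun t => f' (plus X (scal t w))) D 0 t).
simpl in B.
rewrite (scal_zero_l (V := prod_ModuleSpace _ H H)), plus_zero_r, Rminus_0_r in B.
rewrite Rmult_comm; apply B; intros s _; split; [now apply is_partial_line | apply HD].
Qed.

(** The mean value inequality is applied to [f] along the line minus its linear part. The derivative
    at [s] is an increment of [f'], bounded by [Rabs s * D] and thus by [Rabs t * D]. *)
Lemma partial_increment2 {H : HilbertSpace} (w : H * H) (f f' f'' : H * H -> C)
    (D t : R) (X : H * H) :
  is_partial w f f' -> is_partial w f' f'' -> (forall Z, Cmod (f'' Z) <= D) ->
  Cmod (f (plus X (scal t w)) - f X - RtoC t * f' X)%C <= Rabs t ^ 2 * D.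
Proof.
intros Hf Hf' HD.
assert (HD0 : 0 <= D) by exact (Rle_trans _ _ _ (Cmod_ge_0 _) (HD X)).
assert (B := C_bounded_variation
  (fun t => f (plus X (scal t w)) - RtoC t * f' X)%C
  (fun t => f' (plus X (scal t w)) - f' X)%C (Rabs t * D) 0 t).
simpl in B.
rewrite (scal_zero_l (V := prod_ModuleSpace _ H H)), plus_zero_r, Rminus_0_r in B.
replace (f (plus X (scal t w)) - f X - RtoC t * f' X)%C
  with (f (plus X (scal t w)) - RtoC t * f' X - (f X - RtoC 0 * f' X))%C by ring.
refine (Rle_trans _ _ _ (B _) _); [| simpl; nra].
intros s Hs; rewrite !Rminus_0_r in Hs; split.
- apply (is_derive_minus (V := C_R_NormedModule)); [now apply is_partial_line |].
  apply is_derive_ext with (fun t => scal t (f' X : C_R_NormedModule)).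
  + intros r; symmetry; apply RtoC_mult_scal.
  + assert (L := filterdiff_linear (K := R_AbsRing) (V := C_R_NormedModule)
      (F := locally s) (fun t => scal t (f' X : C_R_NormedModule))
      (is_linear_scal_l _)).
    exact L.
- eapply Rle_trans; [now apply (partial_increment w f' f'' D) |].
  now apply Rmult_le_compat_r.
Qed.

Lemma path_increment {H : HilbertSpace} {K : Type} (w : K -> H * H) (y b : K -> R)
    (f : H * H -> C) (ks : list K) (X : H * H) :
  (forall k, In k ks ->
     exists f', is_partial (w k) f f' /\ forall Z, Cmod (f' Z) <= b k) ->
  Cmod (f (plus X (list_sum (fun k => scal (y k) (w k)) ks)) - f X)%C
  <= list_sum (V := R_AbelianMonoid) (fun k => Rabs (y k) * b k) ks.
Proof.
induction ks as [| k ks IH]; simpl; intros Hf.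
- rewrite plus_zero_r.
  replace (f X - f X)%C with (RtoC 0) by ring; rewrite Cmod_0; apply Rle_refl.
- set (S := list_sum _ ks) in *; set (T := list_sum _ ks) in *.
  destruct (Hf k (or_introl eq_refl)) as (f' & Hk & Hb).
  (* The head direction is travelled last, starting from the point [Z] reached by the tail. *)
  rewrite (plus_comm (scal (y k) (w k))), plus_assoc.
  set (Z := plus X S) in *.
  replace (f (plus Z (scal (y k) (w k))) - f X)%C
    with ((f (plus Z (scal (y k) (w k))) - f Z) + (f Z - f X))%C by ring.
  eapply Rle_trans; [apply Cmod_triangle |].
  apply Rplus_le_compat.
  + now apply (partial_increment (w k) f f').
  + apply IH; intros l Hl; apply Hf; now right.
Qed.

(** The head [k] is travelled last, and its derivative [D k] is carried back to [X] along the tail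
    only. Mixed derivatives are thus required just along directions later in the list, which is what
    [ForallOrdPairs] expresses; the pure second derivatives control the single steps. *)
Lemma path_Taylor {H : HilbertSpace} {K : Type} (w : K -> H * H) (y eps : K -> R)
    (M : R) (F : H * H -> C) (D : K -> H * H -> C) (ks : list K) (X : H * H) :
  0 <= M -> (forall k, 0 <= eps k) ->
  (forall k, is_partial (w k) F (D k)) ->
  ForallOrdPairs (fun k l => exists f', is_partial (w l) (D k) f' /\
    forall Z, Cmod (f' Z) <= M * (eps k * eps l)) ks ->
  (forall k, exists f', is_partial (w k) (D k) f' /\
    forall Z, Cmod (f' Z) <= M * (eps k * eps k)) ->
  Cmod (F (plus X (list_sum (fun k => scal (y k) (w k)) ks)) - F X
        - list_sum (V := C_AbelianMonoid) (fun k => RtoC (y k) * D k X)%C ks)%C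
  <= M * list_sum (V := R_AbelianMonoid) (fun k => Rabs (y k) * eps k) ks ^ 2.
Proof.
intros HM Heps HD Hks H2.
induction Hks as [| k ks Hk Hks IH].
- simpl; rewrite plus_zero_r.
  change (@zero C_AbelianMonoid) with (RtoC 0).
  change (@zero R_AbelianMonoid) with 0.
  replace (F X - F X - 0)%C with (RtoC 0) by ring; rewrite Cmod_0; lra.
- assert (PI := path_increment w y (fun l => M * (eps k * eps l)) (D k) ks X).
  rewrite Forall_forall in Hk; specialize (PI Hk); cbv beta in PI.
  replace (list_sum (V := R_AbelianMonoid)
      (fun l => Rabs (y l) * (M * (eps k * eps l))) ks)
    with (M * eps k * list_sum (V := R_AbelianMonoid)
      (fun k => Rabs (y k) * eps k) ks) in PI.
  2: { rewrite <- (list_sum_scal (V := R_NormedModule) (M * eps k)).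
       apply list_sum_ext; intros l; refine (_ : @eq R _ _); unfold scal; simpl; unfold mult; simpl; ring. }
  assert (T0 : 0 <= list_sum (V := R_AbelianMonoid) (fun k => Rabs (y k) * eps k) ks).
  { apply list_sum_nonneg; intros l; apply Rmult_le_pos; [apply Rabs_pos | easy]. }
  destruct (H2 k) as (f'' & Hf'' & Hb).
  simpl list_sum.
  rewrite (plus_comm (scal (y k) (w k))), plus_assoc.
  set (Z := plus X _) in *.
  assert (L := partial_increment2 (w k) F (D k) f'' _ (y k) Z (HD k) Hf'' Hb).
  change (@plus R_AbelianMonoid) with Rplus; change (@plus C_AbelianMonoid) with Cplus.
  set (S := list_sum (V := C_AbelianMonoid) _ ks) in IH |- *.
  set (T := list_sum (V := R_AbelianMonoid) _ ks) in T0, PI, IH |- *.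
  (* Three errors: the last step from [Z], the displacement of [D k] from [Z] to [X], and the
     remainder of the tail. With [a = Rabs (y k) * eps k] they cost [M a^2], [M a T] and [M T^2], in
     total at most [M (a + T)^2]. *)
  replace (F (plus Z (scal (y k) (w k))) - F X - (RtoC (y k) * D k X + S))%C
    with ((F (plus Z (scal (y k) (w k))) - F Z - RtoC (y k) * D k Z)
          + (RtoC (y k) * (D k Z - D k X) + (F Z - F X - S)))%C by ring.
  eapply Rle_trans; [apply Cmod_triangle |].
  eapply Rle_trans; [apply Rplus_le_compat_l, Cmod_triangle |].
  rewrite Cmod_mult, Cmod_R.
  assert (Q : Rabs (y k) * Cmod (D k Z - D k X)%C <= Rabs (y k) * (M * eps k * T))
    by (apply Rmult_le_compat_l; [apply Rabs_pos | exact PI]).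
  assert (P : 0 <= M * (Rabs (y k) * eps k * T)).
  { repeat apply Rmult_le_pos; try easy; apply Rabs_pos. }
  nra.
Qed.

(** * The directions [u_j] and [v_j] *)

Definition dir {H : HilbertSpace} {G : Type} (e : G -> H) (k : G * bool) : H * H :=
  if snd k then u e (fst k) else v e (fst k).

Lemma in_SM_partial {H : HilbertSpace} {G : Type}
    (dec : forall x y : G, {x = y} + {x <> y}) (e : G -> H) (m : nat) (M : R)
    (eps : G -> R) (F : H * H -> C) (k : G * bool) :
  (1 <= m)%nat -> in_SM e m M eps F ->
  is_partial (dir e k) F (partial (dir e k) F) /\
  forall Z, Cmod (partial (dir e k) F Z) <= M * eps (fst k).
Proof.
intros Hm (_ & _ & HF).
destruct k as [j b]; unfold dir; simpl fst; simpl snd.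
(* The multi-index has a single entry 1, at [j], on the side selected by [b]. *)
destruct (HF (j :: nil)
    (fun i => if dec i j then if b then 1 else 0 else 0)%nat
    (fun i => if dec i j then if b then 0 else 1 else 0)%nat)
  as (F' & HF' & _ & HB).
- repeat constructor; easy.
- intros i Hi; destruct (dec i j) as [-> | _]; [| easy].
  exfalso; apply Hi; now left.
- intros i; destruct (dec i j), b; lia.
- simpl in HF', HB; destruct (dec j j) as [_ |]; [| easy].
  assert (Hp : is_partial (if b then u e j else v e j) F F').
  (* Derivatives of order 0 only give pointwise equalities; extensionality collapses the
     intermediate functions. *)
  { destruct HF' as (F1 & F2 & E1 & H2 & H3).
    apply functional_extensionality in E1; subst F1.
    destruct b; simpl in H2, H3.
    - apply functional_extensionality in H2; subst F2.
      destruct H3 as (F3 & E3 & H3).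
      apply functional_extensionality in E3; now subst F3.
    - destruct H2 as (F3 & E2 & H2).
      apply functional_extensionality in E2, H3; now subst F3 F'. }
  assert (E : partial (if b then u e j else v e j) F = F')
    by (apply functional_extensionality; intros; now apply is_partial_unique).
  rewrite E; split; [easy |]; intros Z.
  eapply Rle_trans; [apply HB | apply Req_le].
  destruct b; simpl; ring.
Qed.

(* [is_mixed_partial] only applies the [u_j]-derivatives after the
   [v_j]-derivatives, so [v_j] after [u_j] has to be excluded. *)
Lemma in_SM_partial2 {H : HilbertSpace} {G : Type}
    (dec : forall x y : G, {x = y} + {x <> y}) (e : G -> H) (m : nat) (M : R)
    (eps : G -> R) (F : H * H -> C) (k l : G * bool) :
  (2 <= m)%nat -> in_SM e m M eps F -> (snd k = true -> snd l = true) ->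
  exists F', is_partial (dir e l) (partial (dir e k) F) F' /\
  forall Z, Cmod (F' Z) <= M * (eps (fst k) * eps (fst l)).
Proof.
intros Hm HF Hkl.
assert (HF2 := HF); destruct HF2 as (_ & _ & HF2).
assert (Hk : forall F1, is_partial (dir e k) F F1 -> partial (dir e k) F = F1)
  by (intros; apply functional_extensionality; intros; now apply is_partial_unique).
destruct k as [j b], l as [j' b']; unfold dir in *; simpl fst in *; simpl snd in *.
(* The multi-index is the sum of two unit ones, so its entries reach 2 when [k = l]. For distinct
   indices [j'] heads the list because the head is differentiated last. *)
destruct (HF2 (if dec j j' then j :: nil else j' :: j :: nil)
    (fun i => (if dec i j then if b then 1 else 0 else 0)
              + (if dec i j' then if b' then 1 else 0 else 0))%nat
    (fun i => (if dec i j then if b then 0 else 1 else 0)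
              + (if dec i j' then if b' then 0 else 1 else 0))%nat)
  as (F' & HF' & _ & HB).
- destruct (dec j j'); repeat constructor; simpl; intuition congruence.
- intros i Hi; destruct (dec j j'), (dec i j), (dec i j'); simpl in Hi;
    intuition congruence.
- intros i; destruct (dec i j), (dec i j'), b, b'; lia.
- exists F'.
  enough (L : (exists F1, is_partial (if b then u e j else v e j) F F1 /\
               is_partial (if b' then u e j' else v e j') F1 F') /\
              forall Z, Cmod (F' Z) <= M * (eps j * eps j')).
  { destruct L as ((F1 & H1 & H2) & L); now rewrite (Hk F1 H1). }
  split.
  + destruct (dec j j') as [<- | N]; simpl in HF'.
    * destruct (dec j j) as [_ |]; [| easy].
      destruct HF' as (F1 & F2 & E1 & H2 & H3).
      apply functional_extensionality in E1; subst F1.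
      destruct b, b'; simpl in H2, H3.
      -- apply functional_extensionality in H2; subst F2.
         destruct H3 as (F3 & (F4 & E4 & H4) & H3).
         apply functional_extensionality in E4; subst F4; now exists F3.
      -- discriminate (Hkl eq_refl).
      -- destruct H2 as (F3 & E2 & H2), H3 as (F4 & E3 & H3).
         apply functional_extensionality in E2, E3; subst F3 F4; now exists F2.
      -- apply functional_extensionality in H3; subst F2.
         destruct H2 as (F3 & (F4 & E4 & H4) & H2).
         apply functional_extensionality in E4; subst F4; now exists F3.
    * destruct HF' as (F1 & F2 & (F3 & F4 & E3 & H4 & H1) & H2 & H').
      apply functional_extensionality in E3; subst F3.
      destruct (dec j j) as [_ |]; [| easy].
      destruct (dec j' j') as [_ |]; [| easy].
      destruct (dec j j') as [| _]; [easy |].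
      destruct (dec j' j) as [| _]; [congruence |].
      exists F1; split.
      -- destruct b; simpl in H4, H1.
         ++ destruct H1 as (F5 & E5 & H1).
            apply functional_extensionality in E5, H4; now subst F5 F4.
         ++ destruct H4 as (F5 & E5 & H4).
            apply functional_extensionality in E5, H1; now subst F5 F4.
      -- destruct b'; simpl in H2, H'.
         ++ destruct H' as (F5 & E5 & H5).
            apply functional_extensionality in E5, H2; now subst F5 F2.
         ++ destruct H2 as (F5 & E5 & H5).
            apply functional_extensionality in E5, H'; now subst F5 F2.
  + intros Z; eapply Rle_trans; [apply HB | apply Req_le].
    destruct (dec j j') as [<- | N]; simpl.
    * destruct (dec j j) as [_ |]; [| easy].
      destruct b, b'; simpl; ring.
    * destruct (dec j j) as [_ |]; [| easy].
      destruct (dec j' j') as [_ |]; [| easy].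
      destruct (dec j j') as [| _]; [easy |].
      destruct (dec j' j) as [| _]; [congruence |].
      destruct b, b'; simpl; ring.
Qed.

(** The [v] directions precede the [u] directions, so that every later direction in the list
    satisfies the order condition of [in_SM_partial2]. *)
Definition dirs {G : Type} (s : list G) : list (G * bool) :=
  map (fun j => (j, false)) s ++ map (fun j => (j, true)) s.

Lemma dirs_ordered {G : Type} (s : list G) :
  ForallOrdPairs (fun k l => snd k = true -> snd l = true) (dirs s).
Proof.
(* The two halves are decoupled, so that the induction on the first keeps the second fixed. *)
unfold dirs; generalize s at 1; intros s'; induction s' as [| j s' IH]; simpl.
- induction s as [| j s IH]; simpl; constructor; [| easy].
  apply Forall_forall; intros l Hl; apply in_map_iff in Hl.
  now destruct Hl as (i & <- & _).
- constructor; [| easy].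
  apply Forall_forall; now intros.
Qed.

Lemma list_sum_dirs {G : Type} {V : AbelianMonoid} (f : G * bool -> V) (s : list G) :
  list_sum f (dirs s) = list_sum (fun j => plus (f (j, true)) (f (j, false))) s.
Proof.
unfold dirs; rewrite list_sum_app, !list_sum_map, list_sum_plus; apply plus_comm.
Qed.

Lemma inner2_dir {H : HilbertSpace} {G : Type} (e : G -> H) (Y : H * H)
    (k : G * bool) :
  inner2 Y (dir e k) = inner (if snd k then fst Y else snd Y) (e (fst k)).
Proof.
destruct k as [j []]; unfold dir, inner2; simpl;
  rewrite (inner_sym H _ zero), inner_zero_l; ring.
Qed.

Definition proj2 {H : HilbertSpace} {G : Type} (e : G -> H) (s : list G)
    (Y : H * H) : H * H :=
  (proj e s (fst Y), proj e s (snd Y)).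

Lemma proj2_dirs {H : HilbertSpace} {G : Type} (e : G -> H) (s : list G) (Y : H * H) :
  proj2 e s Y
  = list_sum (V := prod_AbelianMonoid H H)
      (fun k => scal (inner2 Y (dir e k)) (dir e k)) (dirs s).
Proof.
rewrite list_sum_dirs.
induction s as [| j s IH]; [easy |].
simpl; rewrite <- IH, !inner2_dir; unfold proj2, dir; simpl.
assert (Z : forall a : R, scal a (@zero H) = @zero H)
  by (intros; exact (scal_zero_r (V := NormedModule.ModuleSpace _ H) _)).
assert (Zl : forall x : H, plus (@zero H) x = x)
  by (intros; exact (plus_zero_l (G := NormedModule.AbelianMonoid _ H) _)).
assert (Zr : forall x : H, plus x (@zero H) = x)
  by (intros; exact (plus_zero_r (G := NormedModule.AbelianMonoid _ H) _)).
unfold plus at 3 4, scal at 3 4; simpl.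
unfold prod_plus, prod_scal; simpl.
f_equal; f_equal; symmetry.
- refine (eq_trans (f_equal (plus _) (Z _)) (Zr _)).
- refine (eq_trans (f_equal (fun z => plus z _) (Z _)) (Zl _)).
Qed.

Lemma proj2_cvg {H : HilbertSpace} {G : Type}
    (dec : forall x y : G, {x = y} + {x <> y}) (e : G -> H) (Y : H * H) :
  hilbert_basis e ->
  filterlim (fun s => proj2 e s Y) finite_net (locally Y).
Proof.
intros He.
assert (PF := finite_net_filter dec).
intros P [r HP]; change (finite_net (fun s => P (proj2 e s Y))).
assert (HN : forall x y : H, norm (minus x y) < r -> ball x r y).
{ intros x y Hxy; apply ball_sym.
  exact (norm_compat1 (V := CompleteNormedModule.NormedModule _ H) y x r Hxy). }
generalize (filter_and _ _ (proj_cvg e (fst Y) r He (cond_pos r))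
  (proj_cvg e (snd Y) r He (cond_pos r))).
apply filter_imp; intros s [H1 H2]; apply HP; split; now apply HN.
Qed.

Lemma norm_prod_sqr {H : HilbertSpace} (Y : H * H) :
  norm Y ^ 2 = norm (fst Y) ^ 2 + norm (snd Y) ^ 2.
Proof. rewrite inner2_norm; unfold inner2; now rewrite !inner_norm. Qed.

(** Cauchy-Schwarz, then Bessel in each component of [Y]. The factor 2 appears because each [eps j]
    serves both [u_j] and [v_j]. *)
Lemma dirs_sum_bound {H : HilbertSpace} {G : Type}
    (dec : forall x y : G, {x = y} + {x <> y}) (e : G -> H) (eps : G -> R) (S2 : R)
    (s : list G) (Y : H * H) :
  hilbert_basis e -> is_usum (V := R_NormedModule) (fun j => eps j ^ 2) S2 ->
  NoDup s ->
  list_sum (V := R_AbelianMonoid)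
    (fun k => Rabs (inner2 Y (dir e k)) * eps (fst k)) (dirs s) ^ 2
  <= 2 * S2 * norm Y ^ 2.
Proof.
intros He HS Hs.
eapply Rle_trans; [apply list_sum_Cauchy_Schwarz |].
rewrite !list_sum_dirs, !list_sum_plus, norm_prod_sqr; simpl fst.
assert (HE := list_sum_le_usum dec _ S2 s (fun j => pow2_ge_0 (eps j)) HS Hs).
assert (HE0 := list_sum_nonneg (fun j => eps j ^ 2) s (fun j => pow2_ge_0 _)).
assert (Hy : forall b, list_sum (V := R_AbelianMonoid)
    (fun j => Rabs (inner2 Y (dir e (j, b))) ^ 2) s
    <= norm (if b then fst Y else snd Y) ^ 2).
{ intros b; eapply Rle_trans; [| apply (Bessel e _ s He Hs)].
  apply Req_le, list_sum_ext; intros j; rewrite inner2_dir; apply pow2_abs. }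
assert (Ht := Hy true); assert (Hf := Hy false); simpl in Ht, Hf.
assert (Ht0 := list_sum_nonneg (fun j => Rabs (inner2 Y (dir e (j, true))) ^ 2) s
  (fun j => pow2_ge_0 _)).
assert (Hf0 := list_sum_nonneg (fun j => Rabs (inner2 Y (dir e (j, false))) ^ 2) s
  (fun j => pow2_ge_0 _)).
replace (2 * S2 * _) with ((norm (fst Y) ^ 2 + norm (snd Y) ^ 2) * (S2 + S2)) by ring.
apply Rmult_le_compat; try (now apply Rplus_le_le_0_compat);
  now apply Rplus_le_compat.
Qed.

(** * The differential as an unordered sum, and its quadratic remainder *)

Section Differential.

Context {H : HilbertSpace} {G : Type} (dec : forall x y : G, {x = y} + {x <> y}).
Context (e : G -> H) (He : hilbert_basis e) (m : nat) (Hm : (2 <= m)%nat).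
Context (eps : G -> R) (Heps : forall j, 0 <= eps j) (S2 : R).
Context (HS2 : is_usum (V := R_NormedModule) (fun j => eps j ^ 2) S2).
Context (F : H * H -> C).

Definition dterm (X Y : H * H) (j : G) : C :=
  (RtoC (inner2 Y (u e j)) * partial (u e j) F X
   + RtoC (inner2 Y (v e j)) * partial (v e j) F X)%C.

Lemma S2_ge_0 : 0 <= S2.
Proof.
apply (list_sum_le_usum dec _ S2 nil (fun j => pow2_ge_0 (eps j)) HS2), NoDup_nil.
Qed.

Lemma finite_Taylor (M : R) (X Y : H * H) (s : list G) :
  0 <= M -> in_SM e m M eps F -> NoDup s ->
  Cmod (F (plus X (proj2 e s Y)) - F X
        - list_sum (V := C_AbelianMonoid) (dterm X Y) s)%C
  <= M * (2 * S2 * norm Y ^ 2).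
Proof.
intros HM HF Hs.
refine (Rle_trans _ _ _ _ (Rmult_le_compat_l _ _ _ HM
  (dirs_sum_bound dec e eps S2 s Y He HS2 Hs))).
rewrite proj2_dirs.
replace (list_sum (V := C_AbelianMonoid) (dterm X Y) s)
  with (list_sum (V := C_AbelianMonoid)
    (fun k => RtoC (inner2 Y (dir e k)) * partial (dir e k) F X)%C (dirs s))
  by now rewrite list_sum_dirs.
apply (path_Taylor (dir e) (fun k => inner2 Y (dir e k)) (fun k => eps (fst k)) M F
  (fun k => partial (dir e k) F)).
- easy.
- easy.
- intros k; eapply in_SM_partial; try eassumption; lia.
- generalize (dirs_ordered s).
  induction 1 as [| k ks Hk _ IH]; constructor; [| easy].
  revert Hk; apply Forall_impl; intros l Hl.
  eapply in_SM_partial2; eassumption.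
(* For a repeated direction the order condition is trivial. *)
- intros k; eapply in_SM_partial2; eauto.
Qed.

(** A bound uniform in [s] and linear in [norm Y]: it yields both the convergence of the series and
    the continuity of the differential. *)
Lemma dterm_sum_bound (M : R) (X Y : H * H) (s : list G) :
  0 <= M -> in_SM e m M eps F -> NoDup s ->
  list_sum (V := R_AbelianMonoid)
    (fun j => norm (V := C_R_NormedModule) (dterm X Y j)) s
  <= M * sqrt (2 * S2) * norm Y.
Proof.
intros HM HF Hs.
assert (HP : forall k, Cmod (partial (dir e k) F X) <= M * eps (fst k)).
{ intros k; eapply in_SM_partial; try eassumption; lia. }
apply Rle_trans with (M * list_sum (V := R_AbelianMonoid)
    (fun k => Rabs (inner2 Y (dir e k)) * eps (fst k)) (dirs s)).
- rewrite list_sum_dirs, <- (list_sum_scal (V := R_NormedModule) M).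
  apply list_sum_le; intros j; rewrite <- Cmod_norm; unfold dterm.
  eapply Rle_trans; [apply Cmod_triangle |].
  rewrite !Cmod_mult, !Cmod_R.
  assert (L : forall b, Rabs (inner2 Y (dir e (j, b))) * Cmod (partial (dir e (j, b)) F X)
    <= Rabs (inner2 Y (dir e (j, b))) * (M * eps j))
    by (intros b; apply Rmult_le_compat_l; [apply Rabs_pos | apply HP]).
  assert (Lt := L true); assert (Lf := L false); unfold dir in *; simpl in Lt, Lf.
  unfold scal, plus; simpl; unfold mult; simpl; lra.
- rewrite Rmult_assoc; apply Rmult_le_compat_l; [easy |].
  assert (HS := S2_ge_0).
  apply Rsqr_incr_0_var.
  + rewrite Rsqr_mult, Rsqr_sqrt, !Rsqr_pow2 by lra.
    now apply dirs_sum_bound.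
  + apply Rmult_le_pos; [apply sqrt_pos | apply norm_ge_0].
Qed.

(** Definite description yields a total function before convergence is known, with no reference to
    the constant [M]; [differential_usum] shows that its value is the sum. *)
Definition differential (X Y : H * H) : C :=
  iota (T := C_R_CompleteNormedModule)
    (fun l : C_R_CompleteNormedModule => is_usum (V := C_R_NormedModule) (dterm X Y) l).

Lemma differential_usum (X Y : H * H) :
  in_S e m eps F ->
  is_usum (V := C_R_NormedModule) (dterm X Y) (differential X Y).
Proof.
intros (M & HM & HF).
apply (iota_correct (V := C_R_CompleteNormedModule)
  (fun l => is_usum (V := C_R_NormedModule) (dterm X Y) l)).
destruct (ex_usum (V := C_R_CompleteNormedModule) dec (dterm X Y)
  (M * sqrt (2 * S2) * norm Y)) as [l Hl].
- intros s Hs; now apply dterm_sum_bound.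
- exists l; split; [exact Hl |].
  intros l' Hl'; now apply (is_usum_unique (V := C_R_NormedModule) dec (dterm X Y)).
Qed.

(** Additivity and homogeneity follow from uniqueness of unordered sums, boundedness from
    [dterm_sum_bound]. *)
Lemma differential_linear (X : H * H) :
  in_S e m eps F ->
  is_linear (K := R_AbsRing) (V := C_R_NormedModule) (differential X).
Proof.
intros HF.
assert (I2p : forall Y Z w : H * H, inner2 (plus Y Z) w = inner2 Y w + inner2 Z w).
{ intros Y Z w; unfold inner2; simpl; rewrite !inner_plus_l; ring. }
assert (I2s : forall (a : R) (Y w : H * H), inner2 (scal a Y) w = a * inner2 Y w).
{ intros a Y w; unfold inner2; simpl; rewrite !inner_scal_l; ring. }
split.
- intros Y Z.
  apply (is_usum_unique (V := C_R_NormedModule) dec (dterm X (plus Y Z)));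
    [now apply differential_usum |].
  apply is_usum_ext with (fun j => plus (dterm X Y j : C_R_NormedModule) (dterm X Z j)).
  + intros j; unfold dterm; rewrite !I2p, !RtoC_plus.
    change (@plus C_R_NormedModule) with Cplus; refine (_ : @eq C _ _); ring.
  + now apply is_usum_plus; try apply differential_usum.
- intros a Y.
  apply (is_usum_unique (V := C_R_NormedModule) dec (dterm X (scal a Y)));
    [now apply differential_usum |].
  apply is_usum_ext with (fun j => scal a (dterm X Y j : C_R_NormedModule)).
  + intros j; unfold dterm; rewrite !I2s, !RtoC_mult.
    rewrite <- !Cmult_assoc, <- Cmult_plus_distr_l.
    symmetry; apply RtoC_mult_scal.
  + apply is_usum_scal; [easy |]; now apply differential_usum.
- assert (HF' := HF); destruct HF' as (M & HM & HFM).
  assert (HS := S2_ge_0).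
  assert (P : 0 <= M * sqrt (2 * S2)) by (apply Rmult_le_pos; [easy | apply sqrt_pos]).
  (* The operator bound in [is_linear] must be strictly positive, hence the added 1. *)
  exists (M * sqrt (2 * S2) + 1); split; [lra |]; intros Y.
  apply Rle_trans with (M * sqrt (2 * S2) * norm Y).
  + apply (is_usum_norm_le (V := C_R_NormedModule) dec (dterm X Y));
      [now apply differential_usum |].
    intros s Hs; eapply Rle_trans; [apply norm_list_sum | now apply dterm_sum_bound].
  + apply Rmult_le_compat_r; [apply norm_ge_0 | lra].
Qed.

(** The bound of [finite_Taylor] does not depend on [s], so it survives the limit along
    [finite_net]: the projections of [Y] converge, [F] is continuous, and the partial sums converge
    to the differential. *)
Lemma differential_Taylor (M : R) (X Y : H * H) :
  0 <= M -> in_SM e m M eps F ->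
  Cmod (F (plus X Y) - F X - differential X Y)%C <= M * (2 * S2 * norm Y ^ 2).
Proof.
intros HM HF.
assert (PF := finite_net_filter dec).
assert (HD := differential_usum X Y (ex_intro _ M (conj HM HF))).
apply (is_usum_filterlim dec) in HD.
assert (HX : filterlim (fun s => F (plus X (proj2 e s Y))) finite_net
    (locally (T := C_R_NormedModule) (F (plus X Y)))).
{ refine (filterlim_comp _ _ _ _ _ _ _ _ _ (proj1 HF (plus X Y))).
  exact (filterlim_comp_2 _ _ plus (filterlim_const X) (proj2_cvg dec e Y He)
    (filterlim_plus (V := prod_NormedModule _ H H) X Y)). }
assert (HL : filterlim (fun s => norm (V := C_R_NormedModule)
      (minus (minus (F (plus X (proj2 e s Y))) (F X))
        (list_sum (V := C_R_NormedModule) (dterm X Y) s)))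
    finite_net (Rbar_locally
      (norm (V := C_R_NormedModule) (minus (minus (F (plus X Y)) (F X)) (differential X Y))))).
{ refine (filterlim_comp _ _ _ _ _ _ _ _ _ (filterlim_norm (V := C_R_NormedModule) _)).
  assert (HM2 : forall (f g : list G -> C_R_NormedModule) (a b : C_R_NormedModule),
    filterlim f finite_net (locally a) -> filterlim g finite_net (locally b) ->
    filterlim (fun s => minus (f s) (g s)) finite_net (locally (minus a b))).
  { intros f g a b Hf Hg; unfold minus.
    exact (filterlim_comp_2 _ _ plus Hf (filterlim_comp _ _ _ _ _ _ _ _ Hg (filterlim_opp b))
      (filterlim_plus a (opp b))). }
  apply HM2; [| exact HD].
  apply HM2; [exact HX | apply filterlim_const]. }
rewrite Cmod_norm.
refine (filterlim_le (F := finite_net) _ _ (Finite _) (Finite _) _ HL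
  (filterlim_const (M * (2 * S2 * norm Y ^ 2)))).
exists nil; intros s Hs _.
rewrite <- Cmod_norm; now apply finite_Taylor.
Qed.

Lemma differential_filterdiff (X : H * H) :
  in_S e m eps F ->
  filterdiff (K := R_AbsRing) (V := C_R_NormedModule) F (locally X) (differential X).
Proof.
intros HF; split; [now apply differential_linear |].
intros X' HX'.
assert (E := is_filter_lim_locally_unique (V := prod_NormedModule _ H H) X X' HX').
subst X'.
destruct HF as (M & HM & HF); assert (HS := S2_ge_0).
intros r; apply (locally_le_locally_norm (V := prod_NormedModule _ H H)).
assert (HK : 0 < 2 * M * S2 + 1) by nra.
(* Within this radius the remainder [2 M S2 n^2] is at most [r n]; the added 1 keeps the denominator
   positive when [M * S2] vanishes. *)
exists (mkposreal _ (Rdiv_lt_0_compat _ _ (cond_pos r) HK)); intros Z HZ.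
unfold ball_norm in HZ; simpl in HZ.
assert (T := differential_Taylor M X (minus Z X) HM HF).
rewrite Cmod_norm in T.
replace (plus X (minus Z X)) with Z in T.
2: { rewrite plus_comm; symmetry;
     apply (minus_plus_cancel (V := prod_AbelianGroup H H)). }
refine (Rle_trans _ _ _ T _).
set (n := norm _) in HZ |- *.
assert (Hn : 0 <= n) by apply norm_ge_0.
apply Rmult_lt_compat_l with (r := 2 * M * S2 + 1) in HZ; [| easy].
replace ((2 * M * S2 + 1) * (r / (2 * M * S2 + 1))) with (pos r) in HZ by (field; lra).
nra.
Qed.

End Differential.

(** * From admissible constants to their infimum, and conclusion *)

(** Passing to the infimum avoids asking whether it is attained: for [c > 0], [x / c] is a lower
    bound of the admissible constants. *)
Lemma normS_mult_ge {H : HilbertSpace} {G : Type} (e : G -> H) (m : nat)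
    (eps : G -> R) (F : H * H -> C) (x c : R) :
  in_S e m eps F -> 0 <= c ->
  (forall M, 0 <= M -> in_SM e m M eps F -> x <= M * c) ->
  x <= normS e m eps F * c.
Proof.
intros (M0 & HM0 & HF0) Hc Hx; unfold normS.
set (E := fun M => 0 <= M /\ in_SM e m M eps F).
destruct (Glb_Rbar_correct E) as [Hlb Hgl].
assert (H1 := Hlb M0 (conj HM0 HF0)).
assert (H2 : Rbar_le 0 (Glb_Rbar E)) by (apply Hgl; now intros M []).
destruct (Req_dec c 0) as [-> | N].
- rewrite Rmult_0_r; specialize (Hx M0 HM0 HF0); lra.
- assert (H3 : Rbar_le (x / c) (Glb_Rbar E)).
  { apply Hgl; intros M [HM HF]; simpl.
    apply Rle_div_l; [lra | now apply Hx]. }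
  (* The infimum lies between 0 and [M0], so it is finite and [real] does not return its default
     value. *)
  destruct (Glb_Rbar E) as [l | |]; try easy; simpl in *.
  apply Rle_div_l in H3; lra.
Qed.

Theorem proposition4p2
  (H : HilbertSpace) (Hsep : separable H) (Hinf : infinite_dim H)
  (B : CompleteNormedModule R_AbsRing) (i : H -> B) (Hwiener : abstract_wiener i)
  (G : Type) (HG : countable_type G)
  (e : G -> H) (He : hilbert_basis e) (HeB : forall j, in_dual i (e j))
  (m : nat) (Hm : (2 <= m)%nat)
  (eps : G -> R) (Heps : forall j, 0 <= eps j)
  (S2 : R) (HS2 : is_usum (V := R_NormedModule) (fun j => eps j ^ 2) S2)
  (F : H * H -> C) (HF : in_S e m eps F) :
  exists DF : H * H -> H * H -> C,
    (forall X : H * H,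
       filterdiff (K := R_AbsRing) (V := C_R_NormedModule)
         F (locally X) (DF X)) /\
    (forall X Y : H * H,
       is_usum (V := C_R_NormedModule)
         (fun j => (RtoC (inner2 Y (u e j)) * partial (u e j) F X
                    + RtoC (inner2 Y (v e j)) * partial (v e j) F X)%C)
         (DF X Y)) /\
    (forall X Y : H * H,
       Cmod (F (plus X Y) - F X - DF X Y)%C
       <= normS e m eps F * (S2 * (1 + 2 * sqrt 2) * norm Y ^ 2)).
Proof.
destruct (countable_eq_dec G HG) as [dec].
assert (HS := S2_ge_0 dec eps S2 HS2).
(* This gives [2 <= 1 + 2 * sqrt 2], which turns the factor 2 of [differential_Taylor] into the
   stated one. *)
assert (H2 : 1 <= sqrt 2) by (rewrite <- sqrt_1; apply sqrt_le_1_alt; lra).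
exists (differential e F); split; [| split].
- intros X; now apply (differential_filterdiff dec e He m Hm eps Heps S2 HS2).
- intros X Y; now apply (differential_usum dec e He m Hm eps S2 HS2).
- intros X Y.
  assert (HY := pow2_ge_0 (norm Y)).
  assert (HSY := Rmult_le_pos _ _ HS HY).
  (* The same differential serves every admissible [M], so the bound may be proved for each of them
     separately. *)
  apply normS_mult_ge; [easy | nra |]; intros M HM HFM.
  eapply Rle_trans;
    [now apply (differential_Taylor dec e He m Hm eps Heps S2 HS2 F M) |].
  apply Rmult_le_compat_l; [easy | nra].
Qed.
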